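(* Let $\mathbf L=\langle L,\land,\lor,',0,1\rangle$ be a De Morgan bisemilattice. For $x\in L$ put $\uparrow x=\{F\in\mathcal F(L):x\in F\}$ and $\downarrow x=\{I\in\mathcal I(L):x\notin I\}$. Let $X=\{\uparrow x:x\in L\}$ and $Y=\{\downarrow x:x\in L\}$, and define $\theta(\uparrow x)=\downarrow x$ and $(\downarrow x)^\star=\uparrow(x')$. Then: - $X$ is closed under finite intersections and $Y$ under finite unions; - $Y$ has least element $\overline 0=\downarrow 0$; - $\theta:X\to Y$ and ${}^\star:Y\to X$ are well-defined bijections satisfying all the conditions of a DDBS of sets. Hence $\langle X,\cdot,+,{}^\dagger,\bot,\top\rangle$ is a DDBS of sets, and it is isomorphic to $\mathbf L$.
   Context: **Bisemilattices.** A distributive bisemilattice is an algebra $\langle A,\land,\lor\rangle$ in which both operations are idempotent, commutative and associative and each distributes over the other. Write $a\le_\land b$ iff $a\land b=a$, and $a\le_\lor b$ iff $a\lor b=b$. A De Morgan bisemilattice is an algebra $\langle A,\land,\lor,',0,1\rangle$ such that $\langle A,\land,\lor\rangle$ is a distributive bisemilattice, and $x\land1=x$, $x\lor0=x$, $x''=x$, $(x\land y)'=x'\lor y'$, $(x\lor y)'=x'\land y'$. A filter is a nonempty subset that is upward closed for $\le_\land$ and closed under $\land$. An ideal is a nonempty subset that is downward closed for $\le_\lor$ and closed under $\lor$. $\mathcal F(L)$ and $\mathcal I(L)$ denote the sets of filters and ideals. **DDBS of sets.** Let $X$ be a family of sets closed under finite intersections and $Y$ a family of sets closed under finite unions with a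 least element $\overline 0$. Let $\theta:X\to Y$ be a bijection such that: - for all $A,B,C\in X$: $A\cap\theta^{-1}(\theta(B)\cup\theta(C))=\theta^{-1}(\theta(A\cap B)\cup\theta(A\cap C))$; - for all $P,Q,R\in Y$: $P\cup\theta(\theta^{-1}(Q)\cap\theta^{-1}(R))=\theta(\theta^{-1}(P\cup Q)\cap\theta^{-1}(P\cup R))$. Let ${}^\star:Y\to X$ be an inclusion-reversing order isomorphism with ${}^\star\circ\theta=\theta^{-1}\circ({}^\star)^{-1}$. For $A,B\in X$ define: $A+B=\theta^{-1}(\theta(A)\cup\theta(B))$, $A\cdot B=A\cap B$, $A^\dagger=(\theta(A))^\star$, $\bot=\theta^{-1}(\overline0)$, $\top=\overline0^\star$. The resulting structure $\langle X,\cdot,+,{}^\dagger,\bot,\top\rangle$ is called a DDBS of sets. *)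

(* Defs.v *)
From mathcomp Require Import all_boot.
From mathcomp Require Import boolp classical_sets cardinality.
Set Implicit Arguments.
Unset Strict Implicit.
Unset Printing Implicit Defensive.
Local Open Scope classical_set_scope.

Record dm_algebra := DMAlgebra {
  carrier :> Type;
  meet : carrier -> carrier -> carrier;
  join : carrier -> carrier -> carrier;
  neg : carrier -> carrier;
  bot : carrier;
  top : carrier }.

Arguments bot : clear implicits.
Arguments top : clear implicits.

Record distributive_bisemilattice T (meet join : T -> T -> T) : Prop := {
  dbs_meetxx : idempotent_op meet;
  dbs_meetC : commutative meet;
  dbs_meetA : associative meet;
  dbs_joinxx : idempotent_op join;
  dbs_joinC : commutative join;
  dbs_joinA : associative join;
  dbs_meet_joinr : right_distributive meet join;
  dbs_join_meetr : right_distributive join meet }.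

Record de_morgan_bisemilattice (L : dm_algebra) : Prop := {
  dmb_dbs : distributive_bisemilattice (@meet L) (@join L);
  dmb_meetx1 : right_id (top L) (@meet L);
  dmb_joinx0 : right_id (bot L) (@join L);
  dmb_negK : involutive (@neg L);
  dmb_neg_meet : forall x y : L, neg (meet x y) = join (neg x) (neg y);
  dmb_neg_join : forall x y : L, neg (join x y) = meet (neg x) (neg y) }.

Definition dm_isomorphic (A B : dm_algebra) : Prop :=
  exists f : A -> B,
    [/\ bijective f,
        {morph f : x y / meet x y >-> meet x y},
        {morph f : x y / join x y >-> join x y},
        {morph f : x / neg x >-> neg x} &
        f (bot A) = bot B /\ f (top A) = top B].

Section FiltersAndIdeals.
Variable L : dm_algebra.
Implicit Types (x y : L) (F I : set L).

(* Two orders, in general distinct: there is no absorption law. *)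
Definition le_meet x y : Prop := meet x y = x.
Definition le_join x y : Prop := join x y = y.

Definition filters : set (set L) := [set F |
  [/\ F !=set0,
      forall x y, F x -> le_meet x y -> F y &
      forall x y, F x -> F y -> F (meet x y)]].

Definition ideals : set (set L) := [set I |
  [/\ I !=set0,
      forall x y, I y -> le_join x y -> I x &
      forall x y, I x -> I y -> I (join x y)]].

Definition up_filters x : set (set L) := [set F | filters F /\ F x].
Definition down_ideals x : set (set L) := [set I | ideals I /\ ~ I x].

Definition upfam : set (set (set L)) := range up_filters.
Definition downfam : set (set (set L)) := range down_ideals.

Definition upX x : upfam := exist _ (up_filters x) (mem_set (imageT up_filters x)).
Definition downY x : downfam := exist _ (down_ideals x) (mem_set (imageT down_ideals x)).

End FiltersAndIdeals.

Arguments filters : clear implicits.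
Arguments ideals : clear implicits.
Arguments upfam : clear implicits.
Arguments downfam : clear implicits.

(* The empty subfamily is excluded: its intersection would depend on an ambient
   set, and an empty union would make the least element of Y automatic. *)
Definition fin_cap_closed U (X : set (set U)) : Prop :=
  forall D : set (set U), finite_set D -> D !=set0 -> D `<=` X ->
    X (\bigcap_(A in D) A).

Definition fin_cup_closed U (Y : set (set U)) : Prop :=
  forall D : set (set U), finite_set D -> D !=set0 -> D `<=` Y ->
    Y (\bigcup_(P in D) P).

Definition least_member U (Y : set (set U)) (P : set U) : Prop :=
  Y P /\ forall Q, Y Q -> P `<=` Q.

Lemma fin_cap_closed2 U (X : set (set U)) : fin_cap_closed X ->
  forall A B, X A -> X B -> X (A `&` B).
Proof.
move=> hX A B XA XB.
have -> : A `&` B = \bigcap_(C in [set A; B]) C.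
  by rewrite bigcap_setU !bigcap_set1.
apply: hX; first exact: finite_set2.
- by exists A; left.
- by move=> C [] ->.
Qed.

Lemma fin_cup_closed2 U (Y : set (set U)) : fin_cup_closed Y ->
  forall P Q, Y P -> Y Q -> Y (P `|` Q).
Proof.
move=> hY P Q YP YQ.
have -> : P `|` Q = \bigcup_(R in [set P; Q]) R.
  by rewrite bigcup_setU !bigcup_set1.
apply: hY; first exact: finite_set2.
- by exists P; left.
- by move=> R [] ->.
Qed.

Definition cap U (X : set (set U)) (hX : fin_cap_closed X) (A B : X) : X :=
  exist _ (val A `&` val B)
    (mem_set (fin_cap_closed2 hX (set_valP A) (set_valP B))).

Definition cup U (Y : set (set U)) (hY : fin_cup_closed Y) (P Q : Y) : Y :=
  exist _ (val P `|` val Q)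
    (mem_set (fin_cup_closed2 hY (set_valP P) (set_valP Q))).

(* A family of sets is used as the subtype of its members, and each of the
   bijections theta and star is given together with its inverse. *)
Record ddbs_of_sets U V (X : set (set U)) (Y : set (set V)) := DDBS {
  ddbs_capP : fin_cap_closed X;
  ddbs_cupP : fin_cup_closed Y;
  ddbs_zero : Y;
  ddbs_zeroP : least_member Y (val ddbs_zero);
  ddbs_theta : X -> Y;
  ddbs_thetaV : Y -> X;
  ddbs_thetaK : cancel ddbs_theta ddbs_thetaV;
  ddbs_thetaVK : cancel ddbs_thetaV ddbs_theta;
  ddbs_cap_distr : forall A B C : X,
    cap ddbs_capP A
      (ddbs_thetaV (cup ddbs_cupP (ddbs_theta B) (ddbs_theta C))) =
    ddbs_thetaV (cup ddbs_cupP (ddbs_theta (cap ddbs_capP A B))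
                               (ddbs_theta (cap ddbs_capP A C)));
  ddbs_cup_distr : forall P Q R : Y,
    cup ddbs_cupP P
      (ddbs_theta (cap ddbs_capP (ddbs_thetaV Q) (ddbs_thetaV R))) =
    ddbs_theta (cap ddbs_capP (ddbs_thetaV (cup ddbs_cupP P Q))
                              (ddbs_thetaV (cup ddbs_cupP P R)));
  ddbs_star : Y -> X;
  ddbs_starV : X -> Y;
  ddbs_starK : cancel ddbs_star ddbs_starV;
  ddbs_starVK : cancel ddbs_starV ddbs_star;
  ddbs_star_anti : forall P Q : Y,
    val P `<=` val Q <-> val (ddbs_star Q) `<=` val (ddbs_star P);
  ddbs_star_theta : ddbs_star \o ddbs_theta =1 ddbs_thetaV \o ddbs_starV }.

Definition ddbs_algebra U V (X : set (set U)) (Y : set (set V))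
    (D : ddbs_of_sets X Y) : dm_algebra :=
  {| carrier := X;
     meet := cap (ddbs_capP D);
     join := fun A B => ddbs_thetaV D
       (cup (ddbs_cupP D) (ddbs_theta D A) (ddbs_theta D B));
     neg := fun A => ddbs_star D (ddbs_theta D A);
     bot := ddbs_thetaV D (ddbs_zero D);
     top := ddbs_star D (ddbs_zero D) |}.

(* Main.v *)
Require Import Defs.
From mathcomp Require Import all_boot.
From mathcomp Require Import boolp classical_sets cardinality.

Set Implicit Arguments.
Unset Strict Implicit.
Unset Printing Implicit Defensive.

(** Since [le_meet] and [le_join] are partial orders, principal filters and
    principal ideals turn inclusions back into inequalities: [up_filters x] is
    contained in [up_filters y] iff [le_meet x y], and [down_ideals x] is
    contained in [down_ideals y] iff [le_join x y]. So [upX] and [downY] are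
    bijections from [L], which carry meet to intersection and join to union,
    and every condition on a DDBS of sets becomes an identity of [L]. *)

Local Open Scope classical_set_scope.

(** A nonempty finite family is listed by a nonempty sequence, and induction on the tail starts from
    one member, so no empty intersection arises. *)
Lemma setI_fin_cap_closed U (X : set (set U)) :
  (forall A B, X A -> X B -> X (A `&` B)) -> fin_cap_closed X.
Proof.
move=> XI D /finite_seqP[s ->] [A]; case: s => // B s _ {A}.
elim: s B => [|C s IHs] B BsX.
  by rewrite bigcap_seq big_seq1; apply: BsX; rewrite /= mem_head.
rewrite bigcap_seq big_cons -bigcap_seq; apply: XI.
  by apply: BsX; rewrite /= mem_head.
by apply: IHs => A /= As; apply: BsX; rewrite /= in_cons As orbT.
Qed.

Lemma setU_fin_cup_closed U (Y : set (set U)) :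
  (forall P Q, Y P -> Y Q -> Y (P `|` Q)) -> fin_cup_closed Y.
Proof.
move=> YU D /finite_seqP[s ->] [P]; case: s => // Q s _ {P}.
elim: s Q => [|R s IHs] Q QsY.
  by rewrite bigcup_seq big_seq1; apply: QsY; rewrite /= mem_head.
rewrite bigcup_seq big_cons -bigcup_seq; apply: YU.
  by apply: QsY; rewrite /= mem_head.
by apply: IHs => P /= Ps; apply: QsY; rewrite /= in_cons Ps orbT.
Qed.

(** Well-definedness of a map prescribed on the values of [f]: injectivity makes the prescription
    consistent, surjectivity leaves no freedom. *)
Lemma exists_unique_factor A B C (f : A -> B) (g : A -> C) :
  bijective f -> exists! h : B -> C, forall x, h (f x) = g x.
Proof.
case=> fV fK fVK; exists (g \o fV); split=> [x|h hE] /=; first by rewrite fK.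
by apply: funext => y /=; rewrite -hE fVK.
Qed.

Lemma dm_isomorphic_sym (A B : dm_algebra) :
  dm_isomorphic A B -> dm_isomorphic B A.
Proof.
case=> f [[g fK gK] fM fJ fN [f0 f1]]; exists g; split.
- by exists f.
- by move=> x y; rewrite -{1}(gK x) -{1}(gK y) -fM fK.
- by move=> x y; rewrite -{1}(gK x) -{1}(gK y) -fJ fK.
- by move=> x; rewrite -{1}(gK x) -fN fK.
- by rewrite -f0 -f1 !fK.
Qed.

Section DeMorganBisemilattice.
Variables (L : dm_algebra) (hL : de_morgan_bisemilattice L).
Implicit Types x y z : L.

Let meetxx : idempotent_op (@meet L) := dbs_meetxx (dmb_dbs hL).
Let meetC : commutative (@meet L) := dbs_meetC (dmb_dbs hL).
Let meetA : associative (@meet L) := dbs_meetA (dmb_dbs hL).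
Let joinxx : idempotent_op (@join L) := dbs_joinxx (dmb_dbs hL).
Let joinC : commutative (@join L) := dbs_joinC (dmb_dbs hL).
Let joinA : associative (@join L) := dbs_joinA (dmb_dbs hL).

Lemma filters_principal x : filters L [set y | le_meet x y].
Proof.
split=> [|y z /= xy yz|y z /= xy xz]; first by exists x; apply: meetxx.
- by rewrite /le_meet -xy -meetA yz.
- by rewrite /le_meet meetA xy.
Qed.

Lemma ideals_principal x : ideals L [set y | le_join y x].
Proof.
split=> [|y z /= zx yz|y z /= yx zx]; first by exists x; apply: joinxx.
- by rewrite /le_join -zx joinA yz.
- by rewrite /le_join -joinA zx.
Qed.

Lemma up_filters_subset x y :
  up_filters x `<=` up_filters y <-> le_meet x y.
Proof.
split=> [xy|xy F [FF Fx]].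
  (* The principal filter of [x] contains [x], so the inclusion forces it to contain [y]. *)
  by case: (xy [set z | le_meet x z]) => //; split;
    [exact: filters_principal|exact: meetxx].
by split=> //; case: FF => _ Fup _; exact: Fup xy.
Qed.

Lemma down_ideals_subset x y :
  down_ideals x `<=` down_ideals y <-> le_join x y.
Proof.
split=> [xy|xy I [II Ix]].
  (* Otherwise the principal ideal of [y] omits [x], and the inclusion would make it omit [y], which
     it contains. *)
  apply: contrapT => nxy.
  case: (xy [set z | le_join z y]) => [|_]; last by apply; exact: joinxx.
  by split; first exact: ideals_principal.
by split=> // Iy; apply: Ix; case: II => _ Idown _; exact: Idown xy.
Qed.

(** Antisymmetry of [le_meet], which comes from commutativity of [meet]. *)
Lemma up_filters_inj : injective (@up_filters L).
Proof.
move=> x y xy.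
have /up_filters_subset <- : up_filters x `<=` up_filters y by rewrite xy.
rewrite meetC.
by have /up_filters_subset -> : up_filters y `<=` up_filters x by rewrite xy.
Qed.

Lemma down_ideals_inj : injective (@down_ideals L).
Proof.
move=> x y xy.
have /down_ideals_subset <- : down_ideals x `<=` down_ideals y by rewrite xy.
rewrite joinC.
by have /down_ideals_subset -> : down_ideals y `<=` down_ideals x by rewrite xy.
Qed.

Lemma up_filters_meet x y :
  up_filters (meet x y) = up_filters x `&` up_filters y.
Proof.
apply/seteqP; split=> [|F [[FF Fx] [_ Fy]]].
  rewrite subsetI; split; apply/up_filters_subset; rewrite /le_meet.
    by rewrite meetC meetA meetxx.
  by rewrite -meetA meetxx.
by split=> //; case: FF => _ _; apply.
Qed.

(** An ideal containing both [x] and [y] contains their join, so omitting the join means omitting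
    one of them; collecting ideals by omission thus yields a union. *)
Lemma down_ideals_join x y :
  down_ideals (join x y) = down_ideals x `|` down_ideals y.
Proof.
apply/seteqP; split=> [I [II Ixy]|].
  apply: contrapT => /not_orP[nx ny]; apply: Ixy.
  case: (II) => _ _; apply; apply: contrapT => nI; first exact: nx.
  exact: ny.
rewrite subUset; split; apply/down_ideals_subset; rewrite /le_join.
  by rewrite joinA joinxx.
by rewrite joinC -joinA joinxx.
Qed.

Lemma upfam_fin_cap_closed : fin_cap_closed (upfam L).
Proof.
apply: setI_fin_cap_closed => _ _ [x _ <-] [y _ <-].
by rewrite -up_filters_meet; exact: imageT.
Qed.

Lemma downfam_fin_cup_closed : fin_cup_closed (downfam L).
Proof.
apply: setU_fin_cup_closed => _ _ [x _ <-] [y _ <-].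
by rewrite -down_ideals_join; exact: imageT.
Qed.

Lemma down_ideals_bot_least : least_member (downfam L) (down_ideals (bot L)).
Proof.
split=> [|_ [x _ <-]]; first exact: imageT.
by apply/down_ideals_subset; rewrite /le_join joinC (dmb_joinx0 hL).
Qed.

Lemma upX_surj (A : upfam L) : exists x, A = upX x.
Proof. by case: (set_valP A) => x _ xA; exists x; apply: val_inj. Qed.

Lemma downY_surj (P : downfam L) : exists x, P = downY x.
Proof. by case: (set_valP P) => x _ xP; exists x; apply: val_inj. Qed.

Lemma upX_bij : bijective (@upX L).
Proof.
(* A choice of representatives is a right inverse by surjectivity; injectivity of [up_filters] makes
   it a left inverse too. *)
have [g gK] := choice upX_surj; exists g => // x.
by apply: up_filters_inj; exact: esym (congr1 val (gK (upX x))).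
Qed.

Lemma downY_bij : bijective (@downY L).
Proof.
have [g gK] := choice downY_surj; exists g => // x.
by apply: down_ideals_inj; exact: esym (congr1 val (gK (downY x))).
Qed.

Lemma cap_upX (hX : fin_cap_closed (upfam L)) x y :
  cap hX (upX x) (upX y) = upX (meet x y).
Proof. by apply: val_inj; rewrite /= up_filters_meet. Qed.

Lemma cup_downY (hY : fin_cup_closed (downfam L)) x y :
  cup hY (downY x) (downY y) = downY (join x y).
Proof. by apply: val_inj; rewrite /= down_ideals_join. Qed.

(** Needed for the top element, which is obtained as [upX (neg (bot L))]. Here 0' = 0' ∧ 1'' = (0 ∨
    1')' = 1'' = 1. *)
Lemma neg_bot : neg (bot L) = top L.
Proof.
rewrite -(dmb_meetx1 hL (neg _)) -{1}(dmb_negK hL (top L)) -(dmb_neg_join hL).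
by rewrite joinC (dmb_joinx0 hL) (dmb_negK hL).
Qed.

(** De Morgan's law and injectivity of [neg]; this is what makes [star] reverse inclusions. *)
Lemma le_join_neg x y : le_join x y <-> le_meet (neg y) (neg x).
Proof.
rewrite /le_join /le_meet -(dmb_neg_join hL) joinC.
by split=> [-> //|/(can_inj (dmb_negK hL))].
Qed.

Section Ddbs.
Variables (theta : upfam L -> downfam L) (star : downfam L -> upfam L).
Hypotheses (thetaE : forall x, theta (upX x) = downY x).
Hypotheses (starE : forall x, star (downY x) = upX (neg x)).

Lemma theta_bij : bijective theta.
Proof.
have [u uK uVK] := upX_bij; have [d dK dVK] := downY_bij.
exists (@upX L \o d) => [A|P] /=; last by rewrite thetaE dVK.
by rewrite -(uVK A) thetaE dK.
Qed.

(** [star] is the inverse of [downY], then [neg], then [upX], and [neg] is its own inverse. *)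
Lemma star_bij : bijective star.
Proof.
have [u uK uVK] := upX_bij; have [d dK dVK] := downY_bij.
exists (@downY L \o @neg L \o u) => [P|A] /=.
  by rewrite -(dVK P) starE uK (dmb_negK hL).
by rewrite starE (dmb_negK hL) uVK.
Qed.

Lemma exists_ddbs : exists D : ddbs_of_sets (upfam L) (downfam L),
  ddbs_zero D = downY (bot L) /\ ddbs_theta D = theta /\ ddbs_star D = star /\
  dm_isomorphic (ddbs_algebra D) L.
Proof.
have [thetaV thetaK thetaVK] := theta_bij.
have [starV starK starVK] := star_bij.
(* With the inverses computed on [upX x] and [downY x], all four maps are known on every member of
   the families. *)
have thetaVE x : thetaV (downY x) = upX x by rewrite -thetaE thetaK.
have starVE x : starV (upX x) = downY (neg x).
  by rewrite -[x in LHS](dmb_negK hL) -starE starK.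
set hX := upfam_fin_cap_closed; set hY := downfam_fin_cup_closed.
have cap_distr A B C : cap hX A (thetaV (cup hY (theta B) (theta C))) =
    thetaV (cup hY (theta (cap hX A B)) (theta (cap hX A C))).
  have [x ->] := upX_surj A; have [y ->] := upX_surj B.
  have [z ->] := upX_surj C.
  (* Both sides become [upX] of a term of [L], and the terms agree by distributivity. *)
  rewrite !(cap_upX, thetaE, cup_downY, thetaVE).
  by rewrite (dbs_meet_joinr (dmb_dbs hL)).
have cup_distr P Q R : cup hY P (theta (cap hX (thetaV Q) (thetaV R))) =
    theta (cap hX (thetaV (cup hY P Q)) (thetaV (cup hY P R))).
  have [x ->] := downY_surj P; have [y ->] := downY_surj Q.
  have [z ->] := downY_surj R.
  rewrite !(cap_upX, thetaE, cup_downY, thetaVE).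
  by rewrite (dbs_join_meetr (dmb_dbs hL)).
have star_anti (P Q : downfam L) :
    val P `<=` val Q <-> val (star Q) `<=` val (star P).
  have [x ->] := downY_surj P; have [y ->] := downY_surj Q.
  rewrite !starE /=; apply: (iff_trans (down_ideals_subset x y)).
  apply: (iff_trans (le_join_neg x y)).
  exact: iff_sym (up_filters_subset _ _).
have star_theta : star \o theta =1 thetaV \o starV.
  (* Both composites send [upX x] to [upX (neg x)]. *)
  by move=> A; have [x ->] := upX_surj A; rewrite /= thetaE starE starVE thetaVE.
exists (@DDBS _ _ _ _ hX hY (downY (bot L)) down_ideals_bot_least theta thetaV
  thetaK thetaVK cap_distr cup_distr star starV starK starVK star_anti
  star_theta).
(* The isomorphism is the inverse of [upX]; by symmetry the morphism laws are checked on [upX],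
   whose values are explicit. *)
do 3![split=> //]; apply: dm_isomorphic_sym.
exists (@upX L); split=> [|x y|x y|x|] /=; first exact: upX_bij.
- by rewrite cap_upX.
- by rewrite !thetaE cup_downY thetaVE.
- by rewrite thetaE starE.
- by rewrite thetaVE starE neg_bot.
Qed.

End Ddbs.
End DeMorganBisemilattice.

Theorem theorem4p2 (L : dm_algebra) (hL : de_morgan_bisemilattice L) :
  fin_cap_closed (upfam L) /\
  fin_cup_closed (downfam L) /\
  least_member (downfam L) (down_ideals (bot L)) /\
  (exists! theta : upfam L -> downfam L,
     forall x : L, theta (upX x) = downY x) /\
  (exists! star : downfam L -> upfam L,
     forall x : L, star (downY x) = upX (neg x)) /\
  (forall (theta : upfam L -> downfam L) (star : downfam L -> upfam L),
     (forall x : L, theta (upX x) = downY x) ->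
     (forall x : L, star (downY x) = upX (neg x)) ->
     bijective theta /\
     bijective star /\
     exists D : ddbs_of_sets (upfam L) (downfam L),
       ddbs_zero D = downY (bot L) /\
       ddbs_theta D = theta /\
       ddbs_star D = star /\
       dm_isomorphic (ddbs_algebra D) L).
Proof.
split; first exact: upfam_fin_cap_closed.
split; first exact: downfam_fin_cup_closed.
split; first exact: down_ideals_bot_least.
split; first exact: exists_unique_factor (upX_bij hL).
split; first exact: exists_unique_factor (downY_bij hL).
move=> theta star thetaE starE.
split; first exact: theta_bij thetaE.
split; first exact: star_bij starE.
exact: exists_ddbs.
Qed.
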